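(* Let $X$, $Y$ and $Z$ be graphs. (i) If $\varphi\in\mathrm{PC}(X,Y)$ and $\psi\in\mathrm{PC}(Y,Z)$, then $\psi\circ\varphi\in\mathrm{PC}(X,Z)$. (ii) $$\mathrm{Iso}(X,Y)\subseteq\mathrm{O}(X,Y)\cap\mathrm{Com}(X,Y)\subseteq\mathrm{E}(X,Y)\cap\mathrm{Com}(X,Y)\subseteq\mathrm{LS}(X,Y)\cap\mathrm{Com}(X,Y)$$ and $$\mathrm{LS}(X,Y)\cap\mathrm{Com}(X,Y)=\mathrm{PC}(X,Y)=\mathrm{LSur}(X,Y)\cap\mathrm{Com}(X,Y)\subseteq\mathrm{Com}(X,Y).$$
   Context: All graphs are finite, undirected, simple and reflexive: a graph $X=(V_X,E_X)$ has a finite nonempty vertex set $V_X$, and $E_X$ consists of all loops $\{x\}$ ($x\in V_X$; written $\{x,x\}$) together with a (possibly empty) set of $2$-element subsets of $V_X$. A homomorphism $\varphi:X\to Y$ is a map $\varphi:V_X\to V_Y$ such that $\{x_1,x_2\}\in E_X$ implies $\{\varphi(x_1),\varphi(x_2)\}\in E_Y$ (a proper edge may be mapped to a loop). $N_X(x)=\{u\in V_X:\{x,u\}\in E_X\}$ (so $x\in N_X(x)$). The $\varphi$-cells are the nonempty fibres of $\varphi$; they form a partition of $V_X$. The following are sets of homomorphisms $\varphi:X\to Y$: - $\mathrm{Com}(X,Y)$: complete ones, i.e. $\varphi(V_X)=V_Y$ and $\varphi(E_X)=E_Y$. - $\mathrm{Iso}(X,Y)$: isomorphisms, i.e. bijective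 (on vertices) and complete. - $\mathrm{E}(X,Y)$: equitable ones, i.e. the partition $\{P_1,\dots,P_k\}$ of $V_X$ into $\varphi$-cells is equitable: for all $i,j\in\{1,\dots,k\}$ the number $|N_X(x)\cap P_j|$ is the same for all $x\in P_i$. - $\mathrm{O}(X,Y)$: orbit homomorphisms, i.e. the set of $\varphi$-cells is the set of orbits on $V_X$ of some subgroup $\mathfrak{G}\leq\mathrm{Aut}(X)$. - $\mathrm{LSur}(X,Y)$: locally surjective ones, i.e. $\varphi(N_X(x))=N_Y(\varphi(x))$ for all $x\in V_X$. - $\mathrm{LS}(X,Y)$: locally strong ones, i.e. for all $x_1,x_2\in V_X$, $\{\varphi(x_1),\varphi(x_2)\}\in E_Y$ implies that for every $\tilde x_1\in\varphi^{-1}(\varphi(x_1))$ there exists $\tilde x_2\in\varphi^{-1}(\varphi(x_2))$ with $\{\tilde x_1,\tilde x_2\}\in E_X$. - $\mathrm{PC}(X,Y)$: pseudo-covering ones, i.e. locally strong and surjective on vertices. *)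

(* Defs.v *)
From mathcomp Require Import all_boot all_fingroup.

Set Implicit Arguments.
Unset Strict Implicit.
Unset Printing Implicit Defensive.

(* Finite nonempty reflexive simple graphs: the edges are all the singletons
   (loops) and some of the 2-element sets of vertices. *)
Record graph := Graph {
  vertex :> finType;
  edges : {set {set vertex}};
  vertex_nonempty : 0 < #|vertex|;
  edges_loop : forall x : vertex, [set x] \in edges;
  edges_card : forall e : {set vertex}, e \in edges -> #|e| = 1 \/ #|e| = 2
}.

Definition nbhd (X : graph) (x : X) : {set X} := [set u | [set x; u] \in edges X].

Section Homomorphisms.

Variables X Y : graph.

Implicit Type f : {ffun X -> Y}.

Definition Hom : {set {ffun X -> Y}} :=
  [set f : {ffun X -> Y} | [forall x1, forall x2,
     ([set x1; x2] \in edges X) ==> ([set f x1; f x2] \in edges Y)]].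

Definition fibre f (y : Y) : {set X} := f @^-1: [set y].

Definition cells f : {set {set X}} := [set fibre f y | y : Y] :\ set0.

Definition Com : {set {ffun X -> Y}} :=
  [set f in Hom | (f @: [set: X] == [set: Y]) &&
     ([set f @: (e : {set X}) | e in edges X] == edges Y)].

Definition Iso : {set {ffun X -> Y}} :=
  [set f in Com | injectiveb f && (f @: [set: X] == [set: Y])].

Definition equitable (P : {set {set X}}) : bool :=
  [forall A in P, forall B in P, forall x in A, forall x' in A,
     #|nbhd x :&: B| == #|nbhd x' :&: B|].

Definition Equi : {set {ffun X -> Y}} := [set f in Hom | equitable (cells f)].

Definition LSur : {set {ffun X -> Y}} :=
  [set f in Hom | [forall x, f @: nbhd x == nbhd (f x)]].

Definition LS : {set {ffun X -> Y}} :=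
  [set f in Hom | [forall x1, forall x2,
     ([set f x1; f x2] \in edges Y) ==>
     [forall x1' in fibre f (f x1), exists x2' in fibre f (f x2),
        [set x1'; x2'] \in edges X]]].

Definition PC : {set {ffun X -> Y}} :=
  [set f in LS | f @: [set: X] == [set: Y]].

End Homomorphisms.

Definition Aut_graph (X : graph) : {set {perm X}} :=
  [set s : {perm X} | [ffun x => s x] \in Iso X X].

Definition Orb (X Y : graph) : {set {ffun X -> Y}} :=
  [set f in Hom X Y | [exists G : {group {perm X}},
     (G \subset Aut_graph X) && (cells f == [set orbit 'P G x | x : X])]].

(* Main.v *)
(** Completeness lifts each edge of [Y] to some edge of [X].  Local strongness
    asks for a lift starting at every vertex of the fibre over an endpoint:
    equitability provides it, since all vertices of a cell have equally many
    neighbours in any other cell.  Orbit partitions are equitable because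
    an automorphism in the group maps neighbourhoods to neighbourhoods and
    preserves each orbit. *)
Require Import Defs.
From mathcomp Require Import all_boot all_fingroup.

(** A loop is a pair with a repeated vertex, so loops and proper edges can be treated uniformly from
    here on. *)
Lemma edge_pair (X : graph) (e : {set X}) :
  e \in edges X -> exists x y, e = [set x; y].
Proof.
case/edges_card=> /eqP; first move/cards1P=> [x ->]; last case/cards2P=> x [y [_ ->]].
  by exists x, x; rewrite setUid.
by exists x, y.
Qed.

Lemma imset_pair (A B : finType) (f : A -> B) (x y : A) :
  f @: [set x; y] = [set f x; f y].
Proof. by rewrite imsetU1 imset_set1. Qed.

Lemma eq_set2 (T : finType) (a b c d : T) :
  [set a; b] = [set c; d] -> (a = c /\ b = d) \/ (a = d /\ b = c).
Proof.
move=> E.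
have /set2P ha : a \in [set c; d] by rewrite -E set21.
have /set2P hb : b \in [set c; d] by rewrite -E set22.
have /set2P hc : c \in [set a; b] by rewrite E set21.
have /set2P hd : d \in [set a; b] by rewrite E set22.
by case: ha => ?; case: hb => ?; case: hc => ?; case: hd => ?; subst;
  auto.
Qed.

Lemma surjP (A B : finType) (f : A -> B) :
  reflect (forall y, exists x, f x = y) (f @: [set: A] == [set: B]).
Proof.
apply: (iffP eqP) => [E y | S].
  by have := in_setT y; rewrite -E => /imsetP[x _ ->]; exists x.
by apply/setP => y; have [x <-] := S y; rewrite in_setT imset_f.
Qed.

Lemma HomP (X Y : graph) (f : {ffun X -> Y}) :
  reflect (forall x1 x2, [set x1; x2] \in edges X ->
             [set f x1; f x2] \in edges Y) (f \in Hom X Y).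
Proof.
rewrite inE; apply: (iffP forallP) => [H x1 x2 | H x1].
  by move/forallP/(_ x2)/implyP: (H x1).
by apply/forallP => x2; apply/implyP/H.
Qed.

Lemma in_fibre (X Y : graph) (f : {ffun X -> Y}) x y :
  (x \in fibre f y) = (f x == y).
Proof. by rewrite !inE. Qed.

Lemma fibre_in_cells (X Y : graph) (f : {ffun X -> Y}) x :
  fibre f (f x) \in cells f.
Proof.
rewrite !inE imset_f // andbT; apply/set0Pn; exists x.
by rewrite in_fibre.
Qed.

(** The nonempty fibres are those over image points. Indexing cells by vertices of [X] absorbs the
    nonemptiness condition and matches the indexing of orbits. *)
Lemma cellsP (X Y : graph) (f : {ffun X -> Y}) A :
  reflect (exists x, A = fibre f (f x)) (A \in cells f).
Proof.
apply: (iffP idP) => [|[x ->]]; last exact: fibre_in_cells.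
rewrite !inE => /andP[/set0Pn[x] + /imsetP[y _ EA]].
by rewrite EA in_fibre => /eqP <-; exists x.
Qed.

(** Every vertex in the fibre over [f x1] has the same image as [x1] and can take its place, so it
    is enough to lift at [x1] itself, for all [x1]. *)
Lemma LSP (X Y : graph) (f : {ffun X -> Y}) :
  reflect (f \in Hom X Y /\
           forall x1 x2, [set f x1; f x2] \in edges Y ->
             exists2 x2', f x2' = f x2 & [set x1; x2'] \in edges X)
          (f \in LS X Y).
Proof.
rewrite [f \in LS _ _]inE; apply: (iffP andP) => -[fH H]; split=> //.
  move=> x1 x2 e; move/forallP/(_ x1)/forallP/(_ x2)/implyP/(_ e): H.
  move=> /forallP/(_ x1)/implyP; rewrite in_fibre => /(_ (eqxx _)).
  by case/exists_inP => x2'; rewrite in_fibre => /eqP ? ?; exists x2'.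
apply/forallP => x1; apply/forallP => x2; apply/implyP => e.
apply/forall_inP => x1'; rewrite in_fibre => /eqP E1; rewrite -E1 in e.
have [x2' E2 e'] := H _ _ e.
by apply/exists_inP; exists x2'; rewrite // in_fibre E2.
Qed.

Lemma PCP (X Y : graph) (f : {ffun X -> Y}) :
  reflect (f \in LS X Y /\ forall y, exists x, f x = y) (f \in PC X Y).
Proof.
by rewrite [f \in PC _ _]inE; apply: (iffP andP) => -[? /surjP ?].
Qed.

Lemma ComP (X Y : graph) (f : {ffun X -> Y}) :
  reflect [/\ f \in Hom X Y, forall y, exists x, f x = y &
             forall y1 y2, [set y1; y2] \in edges Y ->
               exists x1 x2, [/\ [set x1; x2] \in edges X, f x1 = y1 & f x2 = y2]]
          (f \in Com X Y).
Proof.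
rewrite [f \in Com _ _]inE; apply: (iffP and3P) => -[fH S C];
  split=> //; try exact/surjP.
- move=> y1 y2; rewrite -(eqP C) => /imsetP[e eX].
  have [a [b Ee]] := edge_pair _ _ eX; rewrite {}Ee in eX *.
  (* Edges are unordered, so [a] may lie over [y2] and [b] over [y1]; the two ends are then
     exchanged. *)
  rewrite imset_pair => /eq_set2[[-> ->]|[-> ->]]; first by exists a, b.
  by exists b, a; rewrite setUC.
- apply/eqP/setP => e; apply/imsetP/idP => [[e' eX ->]|eY].
    have [a [b Ee]] := edge_pair _ _ eX; rewrite Ee imset_pair.
    by apply: (HomP _ _ _ fH); rewrite -Ee.
  have [y1 [y2 Ee]] := edge_pair _ _ eY; rewrite Ee in eY.
  have [a [b [eX Ea Eb]]] := C _ _ eY.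
  by exists [set a; b]; rewrite // imset_pair Ea Eb.
Qed.

Lemma LSurP (X Y : graph) (f : {ffun X -> Y}) :
  reflect (f \in Hom X Y /\ forall x, f @: nbhd x = nbhd (f x))
          (f \in LSur X Y).
Proof.
rewrite [f \in LSur _ _]inE; apply: (iffP andP) => -[? H]; split=> //.
  by move=> x; apply/eqP; move/forallP: H.
by apply/forallP => x; apply/eqP.
Qed.

Lemma PC_comp (X Y Z : graph) (phi : {ffun X -> Y}) (psi : {ffun Y -> Z}) :
  phi \in PC X Y -> psi \in PC Y Z -> [ffun x => psi (phi x)] \in PC X Z.
Proof.
move=> /PCP[/LSP[/HomP H1 L1] S1] /PCP[/LSP[/HomP H2 L2] S2].
apply/PCP; split; last first.
  move=> z; have [y <-] := S2 z; have [x <-] := S1 y.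
  by exists x; rewrite ffunE.
apply/LSP; split.
  by apply/HomP => x1 x2 /H1/H2; rewrite !ffunE.
move=> x1 x2; rewrite !ffunE => /L2[y Ey e].
(* The vertex [y] lifted along [psi] need not be [phi x2]. Surjectivity of [phi] makes it an image,
   so that local strongness of [phi] can lift the edge once more. *)
have [x Ex] := S1 y; rewrite -{}Ex in Ey e.
by have [x' Ex' e'] := L1 _ _ e; exists x'; rewrite // ffunE Ex'.
Qed.

(** Vertex surjectivity gives preimages of both ends of an edge, possibly not adjacent; local
    strongness trades the second for a neighbour of the first in the same fibre. *)
Lemma PC_sub_Com (X Y : graph) : PC X Y \subset Com X Y.
Proof.
apply/subsetP => f /PCP[/LSP[fH L] S]; apply/ComP; split=> // y1 y2 e.
have [x1 E1] := S y1; have [x2 E2] := S y2; rewrite -{}E1 -{}E2 in e *.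
by have [x2' E e'] := L _ _ e; exists x1, x2'.
Qed.

Lemma LS_Com_eq_PC (X Y : graph) : LS X Y :&: Com X Y = PC X Y.
Proof.
apply/setP => f; rewrite in_setI; apply/andP/idP => [[fL /ComP[_ S _]]|fP].
  exact/PCP.
by split; [case/PCP: fP | apply: (subsetP (PC_sub_Com X Y))].
Qed.

Lemma LSur_Com_eq_PC (X Y : graph) : PC X Y = LSur X Y :&: Com X Y.
Proof.
apply/setP => f; rewrite in_setI.
apply/idP/andP => [fP | [/LSurP[fH N] /ComP[_ S _]]].
  split; last exact: (subsetP (PC_sub_Com X Y)).
  have [/LSP[fH L] S] := PCP _ _ _ fP; apply/LSurP; split=> // x.
  apply/setP => y; rewrite inE; apply/imsetP/idP => [[u + ->]|].
    by rewrite inE; apply: (HomP _ _ _ fH).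
  (* Local strongness only speaks of edges between image points, so the neighbour [y] of [f x] is
     first written as [f u]. *)
  have [u <-] := S y => /L[u' Eu e].
  by exists u'; rewrite // inE.
apply/PCP; split=> //; apply/LSP; split=> // x1 x2 e.
have : f x2 \in nbhd (f x1) by rewrite inE.
by rewrite -N => /imsetP[x]; rewrite inE => ? ->; exists x.
Qed.

Lemma Equi_Com_sub_LS (X Y : graph) : Equi X Y :&: Com X Y \subset LS X Y.
Proof.
apply/subsetP => f; rewrite in_setI => /andP[+ /ComP[_ S C]].
rewrite inE => /andP[fH eqf]; apply/LSP; split=> // x1 x2 e.
(* The lifted edge starts at [a], which merely shares a cell with [x1]. As [b] makes the count at
   [a] positive, the equal count at [x1] is positive too. *)
have [a [b [eX Ea Eb]]] := C _ _ e.
move/forall_inP/(_ _ (fibre_in_cells _ _ f x1)): eqf.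
move/forall_inP/(_ _ (fibre_in_cells _ _ f x2)).
move/forall_inP/(_ a); rewrite in_fibre => /(_ (introT eqP Ea)).
move/forall_inP/(_ x1); rewrite in_fibre => /(_ (eqxx _))/eqP E.
have : 0 < #|nbhd x1 :&: fibre f (f x2)|.
  by rewrite -E card_gt0; apply/set0Pn; exists b; rewrite inE in_fibre inE eX Eb /=.
rewrite card_gt0 => /set0Pn[x]; rewrite inE in_fibre inE => /andP[? /eqP ?].
by exists x.
Qed.

Lemma Iso_sub_Orb (X Y : graph) : Iso X Y \subset Orb X Y.
Proof.
apply/subsetP => f; rewrite inE => /and3P[fC /injectiveP fI _].
have [fH _ _] := ComP _ _ _ fC.
(* The trivial group works: its orbits are singletons, as are the fibres of an injective map over
   its image points. *)
rewrite inE fH; apply/existsP; exists 1%G; apply/andP; split.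
  apply/subsetP => s /set1P ->; rewrite inE [_ \in Iso _ _]inE; apply/and3P; split.
  - apply/ComP; split.
    + by apply/HomP => x1 x2; rewrite !ffunE !perm1.
    + by move=> y; exists y; rewrite ffunE perm1.
    + by move=> y1 y2 ?; exists y1, y2; rewrite !ffunE !perm1.
  - by apply/injectiveP => x y; rewrite !ffunE !perm1.
  - by apply/surjP => y; exists y; rewrite ffunE perm1.
have fibE x : fibre f (f x) = orbit 'P 1 x.
  by apply/setP => u; rewrite in_fibre (inj_eq fI) /orbit imset_set1 inE act1.
apply/eqP/setP => A; apply/cellsP/imsetP => [[x ->]|[x _ ->]];
  by exists x; rewrite // fibE.
Qed.

Lemma Aut_graph_edge (X : graph) (s : {perm X}) x y :
  s \in Aut_graph X -> [set x; y] \in edges X -> [set s x; s y] \in edges X.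
Proof.
rewrite inE [_ \in Iso _ _]inE => /andP[/ComP[/HomP H _ _] _] /H.
by rewrite !ffunE.
Qed.

Lemma Orb_sub_Equi (X Y : graph) : Orb X Y \subset Equi X Y.
Proof.
apply/subsetP => f; rewrite [f \in Orb _ _]inE => /andP[fH /existsP[G]].
move=> /andP[sG /eqP Ec].
rewrite inE fH /equitable Ec.
(* One inequality suffices, since x and x' play symmetric roles. *)
suff le x x' z : x' \in orbit 'P G x ->
    #|nbhd x :&: orbit 'P G z| <= #|nbhd x' :&: orbit 'P G z|.
  apply/forall_inP => _ /imsetP[w _ ->]; apply/forall_inP => _ /imsetP[z _ ->].
  apply/forall_inP => x hx; apply/forall_inP => x' hx'.
  by rewrite eqn_leq !le // (orbit_trans _ (_ : w \in _)) // orbit_sym.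
(* Here [x'] is the image of [x] under [s]. Replacing the left-hand set by its image under the
   injective [s] reduces the inequality to an inclusion. *)
case/orbitP => s sGs <-; rewrite -(card_imset _ (@perm_inj _ s)).
apply/subset_leq_card/subsetP => _ /imsetP[u /setIP[+ uz] ->].
rewrite !inE => e; apply/andP; split.
  exact: Aut_graph_edge (subsetP sG _ sGs) e.
by apply: orbit_trans uz; apply: mem_orbit.
Qed.

Theorem proposition5p9 (X Y Z : graph) :
  (forall (phi : {ffun X -> Y}) (psi : {ffun Y -> Z}),
     phi \in PC X Y -> psi \in PC Y Z ->
     [ffun x => psi (phi x)] \in PC X Z)
  /\
  (Iso X Y \subset Orb X Y :&: Com X Y /\
   Orb X Y :&: Com X Y \subset Equi X Y :&: Com X Y /\
   Equi X Y :&: Com X Y \subset LS X Y :&: Com X Y /\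
   LS X Y :&: Com X Y = PC X Y /\
   PC X Y = LSur X Y :&: Com X Y /\
   LSur X Y :&: Com X Y \subset Com X Y).
Proof.
split; first exact: PC_comp.
split.
  by rewrite subsetI Iso_sub_Orb; apply/subsetP => f; rewrite inE => /andP[].
split; first exact/setSI/Orb_sub_Equi.
split; first by rewrite subsetI Equi_Com_sub_LS subsetIr.
split; first exact: LS_Com_eq_PC.
split; first exact: LSur_Com_eq_PC.
exact: subsetIr.
Qed.
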